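(* Assume that $F$ is $\mu$-strongly convex and $\eta$-smooth with $0<\mu<\eta$, and that every consensus matrix satisfies the conditions listed in the context. Let the step size be $\beta=1/\eta$. Then for every realization of multi-stage hybrid federated learning (MH-FL), i.e. for every choice of the sampled children, and every $k\ge 1$, $$F(\mathbf w^{(k)})-F(\mathbf w^* )\le\Big(1-\frac{\mu}{\eta}\Big)^{k}\big(F(\mathbf w^{(0)})-F(\mathbf w^* )\big)+\frac{\eta\,\Phi}{2D^2}\sum_{t=0}^{k-1}\Big(1-\frac{\mu}{\eta}\Big)^{t}\,\Xi^{(k-t)},$$ where $\Phi=N_{J-1}+N_{J-2}+\cdots+N_1+N_0$ (with $N_0=1$) is the number of nodes outside the bottom layer, and $$\Xi^{(s)}=\sum_{j=0}^{J-1}\ \sum_{n\in\mathcal N_j}\mathbb 1^{(s)}_{\{Q(n)\}}\,|\mathcal Q^{(s)}(n)|^3\,\big(\lambda^{(s)}_{Q(n)}\big)^{2\theta^{(s)}_{Q(n)}}\big(\Upsilon^{(s)}_{Q(n)}\big)^2 .$$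
   Context: **Network.** Fix an integer $J\ge 1$ (the number of layers below the server). For $0\le j\le J$ let $\mathcal N_j$ be a finite nonempty set (the nodes of layer $j$), $N_j=|\mathcal N_j|$; $\mathcal N_0=\{0\}$ is the main server, so $N_0=1$; $\mathcal N_J$ are the end devices. At each global iteration $k\ge1$, each node $n\in\mathcal N_j$, $0\le j\le J-1$, has a nonempty set of children $\mathcal Q^{(k)}(n)\subseteq\mathcal N_{j+1}$, and the sets $\mathcal Q^{(k)}(n)$, $n\in\mathcal N_j$, partition $\mathcal N_{j+1}$ (they may change with $k$). The cluster below $n$ is denoted $Q(n)$; its node set at iteration $k$ is $\mathcal Q^{(k)}(n)$. Thus clusters of layer $j+1$ are in bijection with nodes of layer $j$. At iteration $k$ each cluster $C$ operates either in LUT mode ($\mathbb 1^{(k)}_{\{C\}}=1$) or in EUT mode ($\mathbb 1^{(k)}_{\{C\}}=0$). **Loss.** Each end device $n\in\mathcal N_J$ has a finite nonempty dataset $\mathcal D_n$ and a differentiable local loss $f_n:\mathbb R^M\to\mathbb R$. Put $D=\sum_{n\in\mathcal N_J}|\mathcal D_n|$, $F(\mathbf w)=\frac1D\sum_{n\in\mathcal N_J}|\mathcal D_n|f_n(\mathbf w)$, and $\mathbf w^*=\arg\min_{\mathbf w\in\mathbb R^M}F(\mathbf w)$. $\mu$-strong convexity: $F(\mathbf y)\ge F(\mathbf x)+(\mathbf y-\mathbf x)^\top\nabla F(\mathbf x)+\frac\mu2\|\mathbf y-\mathbf x\|^2$ for all $\mathbf x,\mathbf y$; $\eta$-smoothness: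 $\|\nabla F(\mathbf x)-\nabla F(\mathbf y)\|\le\eta\|\mathbf x-\mathbf y\|$ for all $\mathbf x,\mathbf y$. $\|\cdot\|$ is the Euclidean norm. **Consensus matrices.** For a cluster $C$ with node set $\mathcal C^{(k)}$ that is LUT at iteration $k$, there is a connected undirected graph $G_C^{(k)}$ on $\mathcal C^{(k)}$, a number of device-to-device (D2D) rounds $\theta^{(k)}_C\in\{0,1,2,\dots\}$, and a real matrix $\mathbf V^{(k)}_C$ indexed by $\mathcal C^{(k)}$ with: (i) $(\mathbf V_C^{(k)})_{m,n}=0$ if $m\ne n$ are not adjacent in $G_C^{(k)}$; (ii) $\mathbf V_C^{(k)}\mathbf 1=\mathbf 1$; (iii) $\mathbf V_C^{(k)}$ is symmetric; (iv) the spectral radius satisfies $\rho\big(\mathbf V_C^{(k)}-\mathbf 1\mathbf 1^\top/|\mathcal C^{(k)}|\big)\le\lambda^{(k)}_C<1$ for a given number $\lambda_C^{(k)}$. (Convention $0^0=1$.) **MH-FL.** Start from $\mathbf w^{(0)}\in\mathbb R^M$. At iteration $k\ge1$, each end device $n\in\mathcal N_J$ computes $\mathbf w_n^{(k)}=\mathbf w^{(k-1)}-\beta\nabla f_n(\mathbf w^{(k-1)})$ and sets its scaled parameter $\widetilde{\mathbf w}^{(k)}_n=|\mathcal D_n|\mathbf w^{(k)}_n$. Then for $j=J-1,J-2,\dots,0$ each node $n\in\mathcal N_j$ with child cluster $C=Q(n)$ obtains $\widetilde{\mathbf w}_n^{(k)}$ as follows. If $C$ is EUT: $\widetilde{\mathbf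 w}_n^{(k)}=\sum_{i\in\mathcal Q^{(k)}(n)}\widetilde{\mathbf w}^{(k)}_i$. If $C$ is LUT: let $\widetilde{\mathbf W}_C^{(k)}$ be the matrix whose rows are $\widetilde{\mathbf w}_i^{(k)}$, $i\in\mathcal Q^{(k)}(n)$, let $\widehat{\mathbf W}_C^{(k)}=(\mathbf V_C^{(k)})^{\theta_C^{(k)}}\widetilde{\mathbf W}_C^{(k)}$ with rows $\widehat{\mathbf w}_i^{(k)}$; the parent samples one (arbitrary) child $n'\in\mathcal Q^{(k)}(n)$ and sets $\widetilde{\mathbf w}_n^{(k)}=|\mathcal Q^{(k)}(n)|\,\widehat{\mathbf w}_{n'}^{(k)}$. Finally the server sets $\mathbf w^{(k)}=\widetilde{\mathbf w}_0^{(k)}/D$. **Divergence.** For each cluster $C$ and iteration $k$, $\Upsilon_C^{(k)}$ is a number with $\|\widetilde{\mathbf w}_q^{(k)}-\widetilde{\mathbf w}_{q'}^{(k)}\|\le\Upsilon_C^{(k)}$ for all $q,q'\in\mathcal C^{(k)}$. *)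

(* Defs.v *)
From HB Require Import structures.
From mathcomp Require Import all_boot all_order all_algebra.
From mathcomp Require Import complex.
From mathcomp Require Import all_classical all_reals all_analysis.
Set Implicit Arguments.
Unset Strict Implicit.
Unset Printing Implicit Defensive.
Import Order.TTheory GRing.Theory Num.Theory.
Import numFieldNormedType.Exports.
Local Open Scope ring_scope.

Definition dot (R : realType) (M : nat) (u v : 'rV[R]_M) : R :=
  \sum_(i < M) u 0 i * v 0 i.

(* The library norm `|u| on 'rV[R]_M is the sup norm, hence this one. *)
Definition enorm (R : realType) (M : nat) (u : 'rV[R]_M) : R :=
  Num.sqrt (dot u u).

Definition grad (R : realType) (M : nat) (f : 'rV[R]_M -> R) (x : 'rV[R]_M) :
    'rV[R]_M :=
  \row_(i < M) 'D_(delta_mx 0 i) f x.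

Definition strongly_convex (R : realType) (M : nat) (mu : R)
    (f : 'rV[R]_M -> R) : Prop :=
  forall x y,
    f y >= f x + dot (y - x) (grad f x) + mu / 2 * enorm (y - x) ^+ 2.

Definition smooth (R : realType) (M : nat) (eta : R) (f : 'rV[R]_M -> R) :
    Prop :=
  forall x y, enorm (grad f x - grad f y) <= eta * enorm (x - y).

(* For n = 0 the set is empty and the value is 0. *)
Definition spectral_radius (R : realType) (n : nat) (A : 'M[R]_n) : R :=
  sup [set r : R | exists2 z : R[i],
         eigenvalue (map_mx (real_complex R) A) z & r = Normc.normc z]%classic.

(* Layers are indexed by all of nat to avoid dependent casts; only the layers
   0..J and the iterations k >= 1 are constrained or ever used. *)
Record network (J : nat) := Network {
  node : nat -> finType;
  server : node 0;
  serverP : forall n : node 0, n = server;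
  node_gt0 : forall j, (j <= J)%N -> (0 < #|node j|)%N;
  children : nat -> forall j, node j -> {set node j.+1};
  children_gt0 : forall k j (n : node j), (0 < k)%N -> (j < J)%N ->
    (0 < #|children k n|)%N;
  children_disjoint : forall k j (n n' : node j), (0 < k)%N -> (j < J)%N ->
    n != n' -> [disjoint children k n & children k n'];
  children_cover : forall k j (q : node j.+1), (0 < k)%N -> (j < J)%N ->
    exists n : node j, q \in children k n
}.

Arguments children {J} _ k {j} n.
Arguments server {J} _.

(* A cluster is named by its parent n.  Its nodes are numbered by
   'I_#|children H k n|, the i-th one being enum_val i. *)
Record d2d (R : realType) (J : nat) (H : network J) := D2D {
  lut : nat -> forall j, node H j -> bool;
  graph : forall k j (n : node H j), rel 'I_#|children H k n|;
  rounds : nat -> forall j, node H j -> nat;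
  consensus : forall k j (n : node H j), 'M[R]_#|children H k n|;
  rate : nat -> forall j, node H j -> R
}.

Arguments lut {R J H} _ k {j} n.
Arguments graph {R J H} _ k {j} n.
Arguments rounds {R J H} _ k {j} n.
Arguments consensus {R J H} _ k {j} n.
Arguments rate {R J H} _ k {j} n.

Record consensus_conditions (R : realType) (J : nat) (H : network J)
    (P : d2d R H) (k j : nat) (n : node H j) : Prop := ConsensusConditions {
  graph_sym : symmetric (graph P k n);
  graph_connected : forall a b, connect (graph P k n) a b;
  consensus_supp : forall a b, a != b -> ~~ graph P k n a b ->
    consensus P k n a b = 0;
  consensus_stoch : consensus P k n *m const_mx 1 = const_mx 1 :> 'cV[R]_ _;
  consensus_sym : (consensus P k n)^T = consensus P k n;
  consensus_radius :
    spectral_radius (consensus P k n - const_mx (#|children H k n|%:R^-1))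
      <= rate P k n;
  rate_lt1 : rate P k n < 1
}.

Section Learning.
Variables (R : realType) (J : nat) (H : network J) (P : d2d R H).
Variables (M : nat) (data : node H J -> finType).
Variable f : node H J -> 'rV[R]_M -> R.

Definition data_total : nat := (\sum_(n : node H J) #|data n|)%N.

Definition global_loss (x : 'rV[R]_M) : R :=
  data_total%:R^-1 * \sum_(n : node H J) #|data n|%:R * f n x.

(* wt k j n is the scaled parameter of node n at iteration k. *)
Definition cluster_mx (wt : nat -> forall j, node H j -> 'rV[R]_M)
    (k j : nat) (n : node H j) : 'M[R]_(#|children H k n|, M) :=
  \matrix_(i < #|children H k n|) wt k j.+1 (enum_val i).

(* The relation "(w, wt) is a realization of MH-FL": the sampled child of a LUT
   cluster is existentially quantified, independently for each k and n, so that
   quantifying over all (w, wt) ranges over all sampling choices. *)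
Record mhfl (beta : R) (w0 : 'rV[R]_M) (w : nat -> 'rV[R]_M)
    (wt : nat -> forall j, node H j -> 'rV[R]_M) : Prop := MHFL {
  mhfl_init : w 0%N = w0;
  mhfl_device : forall k (n : node H J), (0 < k)%N ->
    wt k J n = #|data n|%:R *: (w k.-1 - beta *: grad (f n) (w k.-1));
  mhfl_eut : forall k j (n : node H j), (0 < k)%N -> (j < J)%N ->
    ~~ lut P k n -> wt k j n = \sum_(i in children H k n) wt k j.+1 i;
  mhfl_lut : forall k j (n : node H j), (0 < k)%N -> (j < J)%N ->
    lut P k n -> exists c : 'I_#|children H k n|,
      wt k j n = #|children H k n|%:R *:
        row c (consensus P k n ^+ rounds P k n *m cluster_mx wt k n);
  mhfl_server : forall k, (0 < k)%N ->
    w k = data_total%:R^-1 *: wt k 0%N (server H)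
}.

Definition divergence_bound (wt : nat -> forall j, node H j -> 'rV[R]_M)
    (Upsilon : nat -> forall j, node H j -> R) : Prop :=
  forall k j (n : node H j), (0 < k)%N -> (j < J)%N ->
    {in children H k n &, forall q q',
      enorm (wt k j.+1 q - wt k j.+1 q') <= Upsilon k j n}.

Definition Phi : nat := (\sum_(j < J) #|node H j|)%N.

Definition Xi (Upsilon : nat -> forall j, node H j -> R) (s : nat) : R :=
  \sum_(j < J) \sum_(n : node H j)
    (lut P s n)%:R * #|children H s n|%:R ^+ 3 *
    rate P s n ^+ (2 * rounds P s n) * Upsilon s j n ^+ 2.
End Learning.

(* Main.v *)
(* Summing w~_n - (sum of the children's w~) over all nodes n above the bottom
   layer telescopes, so one iteration is the exact gradient step
   w - grad F(w) / eta perturbed by E / D, where E is the sum of the sampling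
   errors of the LUT clusters.  Smoothness gives a decrease of
   |grad F|^2 / (2 eta) at the cost (eta / 2) |E / D|^2: at step size 1 / eta
   the cross terms in E cancel.  Strong convexity bounds |grad F|^2 below by
   2 mu (F - min F), which yields the contraction factor 1 - mu / eta.
   The Phi summands of E satisfy |E|^2 <= Phi * sum |e_n|^2, and each
   |e_n|^2 <= |C|^3 lambda^(2 theta) Upsilon^2 because V - 11^T / |C| is
   symmetric, so its operator norm is its spectral radius. *)
Require Import Defs.
From mathcomp Require Import all_boot all_order all_algebra.
From mathcomp Require Import complex.
From mathcomp Require Import all_classical all_reals all_analysis.
From mathcomp Require Import ring lra.
Import Order.TTheory GRing.Theory Num.Theory.
Import numFieldNormedType.Exports.
Local Open Scope ring_scope.
Local Open Scope sesquilinear_scope.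

(** * Frobenius norm and spectral radius of symmetric matrices *)

Definition frob2 {R : pzRingType} {m n : nat} (X : 'M[R]_(m, n)) : R :=
  \sum_i \sum_j X i j ^+ 2.

Definition cfrob2 {C : numClosedFieldType} {m n : nat} (X : 'M[C]_(m, n)) : C :=
  \sum_i \sum_j `|X i j| ^+ 2.

Lemma cfrob2E (C : numClosedFieldType) (m n : nat) (X : 'M[C]_(m, n)) :
  cfrob2 X = \tr (X^t* *m X).
Proof.
rewrite mxtrace_mulC /mxtrace; apply: eq_bigr => i _; rewrite mxE.
by apply: eq_bigr => j _; rewrite !mxE normCK.
Qed.

Lemma cfrob2_unitary (C : numClosedFieldType) (m n : nat) (U : 'M[C]_m)
    (X : 'M[C]_(m, n)) :
  U \is unitarymx -> cfrob2 (U *m X) = cfrob2 X.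
Proof.
rewrite -trmxC_unitary => /unitarymxP; rewrite trmxCK => UU.
by rewrite !cfrob2E trmx_mul map_mxM mulmxA -(mulmxA _ _ U) UU mulmx1.
Qed.

Lemma cfrob2_diag (C : numClosedFieldType) (m n : nat) (d : 'rV[C]_m)
    (X : 'M[C]_(m, n)) (l : C) :
  (forall i, `|d 0 i| <= l) ->
  cfrob2 (diag_mx d *m X) <= l ^+ 2 * cfrob2 X.
Proof.
move=> dl; rewrite mulr_sumr; apply: ler_sum => i _.
rewrite mulr_sumr; apply: ler_sum => j _.
rewrite mul_diag_mx mxE normrM exprMn ler_wpM2r ?exprn_ge0 //.
by rewrite lerXn2r ?nnegrE ?(le_trans _ (dl i)) //.
Qed.

(** The rows of [P = spectralmx A] are left eigenvectors, because [P A = D P] with [D] diagonal;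
    they are nonzero because [P] is invertible. *)
Lemma eigenvalue_spectral_diag (C : numClosedFieldType) (m : nat)
    (A : 'M[C]_m) (i : 'I_m) :
  A \is normalmx -> eigenvalue A (spectral_diag A 0 i).
Proof.
move=> /orthomx_spectralP AE; set P := spectralmx A in AE.
have Pu : P \in unitmx by apply: spectral_unit.
apply/eigenvalueP; exists (row i P).
  rewrite -row_mul [in P *m A]AE !mulmxA mulmxV // mul1mx row_mul.
  by rewrite row_diag_mx -scalemxAl -rowE.
apply/negP => /eqP Pi0; move: Pu; rewrite -row_free_unit => /row_freeP [B PB].
have := congr1 (row i) PB; rewrite row_mul Pi0 mul0mx => /matrixP /(_ 0 i).
by rewrite !mxE eqxx => /esym/eqP; rewrite oner_eq0.
Qed.

Lemma normc_normr (R : rcfType) (z : R[i]) :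
  `|z| = real_complex R (Normc.normc z).
Proof. by rewrite normc_def; case: z. Qed.

(** A [sup] dominates the members of its set once the set is bounded. Eigenvalues are roots of the
    characteristic polynomial, so the sum of the moduli of its roots is an upper bound. *)
Lemma normc_le_spectral_radius (R : realType) (n : nat) (A : 'M[R]_n)
    (z : R[i]) :
  eigenvalue (map_mx (real_complex R) A) z ->
  Normc.normc z <= spectral_radius A.
Proof.
move=> zA; apply: ub_le_sup; last by exists z.
have [r rE] := closed_field_poly_normal (char_poly (map_mx (real_complex R) A)).
exists (\sum_(y <- r) Normc.normc y) => _ [y yA ->].
have : y \in r.
  move: yA; rewrite eigenvalue_root_char rE.
  by rewrite (monicP (char_poly_monic _)) scale1r root_prod_XsubC.
have nn (x : R[i]) : 0 <= Normc.normc x by case: x => a b; rewrite sqrtr_ge0.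
elim: r {rE} => // a r IH; rewrite in_cons big_cons => /orP[/eqP->|/IH le].
  by rewrite lerDl sumr_ge0.
by rewrite (le_trans le) // lerDr.
Qed.

(** Over [R[i]] the symmetric matrix [A] is normal, hence unitarily diagonalisable. Unitary factors
    preserve the Frobenius norm, and the diagonal entries are eigenvalues, of modulus at most
    [l]. *)
Lemma frob2_mulmx (R : realType) (m n : nat) (A : 'M[R]_m)
    (X : 'M[R]_(m, n)) (l : R) :
  A^T = A -> spectral_radius A <= l ->
  frob2 (A *m X) <= l ^+ 2 * frob2 X.
Proof.
move=> Asym Al; pose c : {rmorphism R -> R[i]} := real_complex R.
have creal (x : R) : c x \is Num.real.
  by rewrite realE -[0](rmorph0 c) !lecR le_total.
have cfrob2c (k : nat) (Y : 'M[R]_(m, k)) :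
    cfrob2 (map_mx c Y) = c (frob2 Y).
  rewrite rmorph_sum; apply: eq_bigr => i _; rewrite rmorph_sum.
  by apply: eq_bigr => j _; rewrite mxE rmorphXn real_normK.
rewrite -lecR.
have Anormal : map_mx c A \is normalmx.
  apply: symmetric_normalmx; last by apply/mxOverP => i j; rewrite mxE.
  by apply/is_hermitianmxP; rewrite expr0 scale1r map_mx_id // map_trmx Asym.
have /orthomx_spectralP AE := Anormal.
have PU := spectral_unitarymx (map_mx c A); set Q := spectralmx _ in PU AE.
have QA : Q *m map_mx c A = diag_mx (spectral_diag (map_mx c A)) *m Q.
  by rewrite {1}AE !mulmxA mulmxV ?mul1mx // unitarymx_unit.
rewrite -[X in X <= _]/(c _) -[X in _ <= X]/(c _) rmorphM rmorphXn -!cfrob2c.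
rewrite map_mxM -(cfrob2_unitary _ _ _ _ (map_mx c A *m _) PU).
rewrite mulmxA QA -mulmxA.
rewrite -(cfrob2_unitary _ _ _ _ (map_mx c X) PU); apply: cfrob2_diag => i.
rewrite normc_normr lecR (le_trans _ Al) //.
by apply: normc_le_spectral_radius; apply: eigenvalue_spectral_diag.
Qed.

(** * The Euclidean inner product *)

Section Dot.
Context {R : realType} {M : nat}.
Implicit Types u v : 'rV[R]_M.

Lemma dotC u v : dot u v = dot v u.
Proof. by apply: eq_bigr => i _; rewrite mulrC. Qed.

Lemma dotDl u v x : dot (u + v) x = dot u x + dot v x.
Proof. by rewrite -big_split; apply: eq_bigr => i _; rewrite mxE mulrDl. Qed.

Lemma dotZl a u v : dot (a *: u) v = a * dot u v.
Proof. by rewrite mulr_sumr; apply: eq_bigr => i _; rewrite mxE mulrA. Qed.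

Lemma dotDr u v x : dot x (u + v) = dot x u + dot x v.
Proof. by rewrite dotC dotDl !(dotC x). Qed.

Lemma dotZr a u v : dot u (a *: v) = a * dot u v.
Proof. by rewrite dotC dotZl dotC. Qed.

Lemma dotNl u v : dot (- u) v = - dot u v.
Proof. by rewrite -scaleN1r dotZl mulN1r. Qed.

Lemma dotNr u v : dot u (- v) = - dot u v.
Proof. by rewrite dotC dotNl dotC. Qed.

Lemma dot0l v : dot 0 v = 0.
Proof. by rewrite -(scale0r 0) dotZl mul0r. Qed.

Lemma dot_ge0 u : 0 <= dot u u.
Proof. by apply: sumr_ge0 => i _; rewrite -expr2 sqr_ge0. Qed.

Lemma sqr_enorm u : enorm u ^+ 2 = dot u u.
Proof. by rewrite sqr_sqrtr ?dot_ge0. Qed.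

Lemma dot_le_sqr u (c : R) : enorm u <= c -> dot u u <= c ^+ 2.
Proof.
move=> uc; rewrite -sqr_enorm lerXn2r ?nnegrE ?sqrtr_ge0 //.
by rewrite (le_trans _ uc) ?sqrtr_ge0.
Qed.

Lemma dot_suml (I : finType) (F : I -> 'rV[R]_M) v :
  dot (\sum_i F i) v = \sum_i dot (F i) v.
Proof.
by apply: (big_morph (fun u => dot u v)) => [x y|]; rewrite ?dotDl ?dot0l.
Qed.

Lemma dot_sumr (I : finType) (F : I -> 'rV[R]_M) v :
  dot v (\sum_i F i) = \sum_i dot v (F i).
Proof. by rewrite dotC dot_suml; apply: eq_bigr => i _; rewrite dotC. Qed.

Lemma dot_le_mean u v : dot u v <= (dot u u + dot v v) / 2.
Proof.
have := dot_ge0 (u - v); rewrite !(dotDl, dotDr, dotNl, dotNr) (dotC v u).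
lra.
Qed.

(** Expand the square and bound each cross term by the mean of two squares; every square is then
    counted [#|I|] times. *)
Lemma dot_sum_le (I : finType) (F : I -> 'rV[R]_M) :
  dot (\sum_i F i) (\sum_i F i) <= #|I|%:R * \sum_i dot (F i) (F i).
Proof.
rewrite dot_suml.
apply: (@le_trans _ _ (\sum_i \sum_j (dot (F i) (F i) + dot (F j) (F j)) / 2)).
  apply: ler_sum => i _; rewrite dot_sumr; apply: ler_sum => j _.
  exact: dot_le_mean.
set S := \sum_i dot (F i) (F i).
have -> : \sum_i \sum_j (dot (F i) (F i) + dot (F j) (F j)) / 2 =
    (S *+ #|I| + S *+ #|I|) / 2.
  under eq_bigr do rewrite -mulr_suml big_split /= sumr_const.
  by rewrite -mulr_suml big_split /= sumr_const -sumrMnl.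
by rewrite -(mulr_natl S); lra.
Qed.

End Dot.

(** * Directional derivatives and the descent inequality *)

Lemma dot_gradE (R : realType) (M : nat) (f : 'rV[R]_M -> R) (x v : 'rV[R]_M) :
  differentiable f x -> dot (grad f x) v = 'D_v f x.
Proof.
move=> df; rewrite deriveE // [in RHS](row_sum_delta v) linear_sum.
by apply: eq_bigr => i _; rewrite linearZ mxE deriveE // mulrC.
Qed.

Lemma is_derive_line (R : realType) (M : nat) (f : 'rV[R]_M -> R)
    (x v : 'rV[R]_M) (t : R) :
  differentiable f (x + t *: v) ->
  is_derive t 1 (fun s : R => f (x + s *: v)) (dot (grad f (x + t *: v)) v).
Proof.
move=> df; rewrite dot_gradE //.
have quotientE :
    (fun h : R => h^-1 *: (((fun s : R => f (x + s *: v)) \o shift t)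
      (h *: 1) - f (x + t *: v))) =
    (fun h : R => h^-1 *:
      ((f \o shift (x + t *: v)) (h *: v) - f (x + t *: v))).
  apply: funext => h /=; congr (_ *: (f _ - _)).
  by rewrite scalerDl -scalerA scale1r addrCA.
have := @diff_derivable _ _ _ f _ v df; rewrite /derivable -quotientE => dp.
by apply: DeriveDef => //; rewrite /derive quotientE.
Qed.

(** The mean value theorem is applied to [p], the gap between [f] on the segment and its quadratic
    majorant: [p 1 - p 0] is a value of [dp] inside the segment, and smoothness makes that value
    nonpositive. *)
Lemma descent (R : realType) (M : nat) (f : 'rV[R]_M -> R) (eta : R)
    (x v : 'rV[R]_M) :
  0 < eta -> (forall z, differentiable f z) -> smooth eta f ->
  f (x + v) <= f x + dot (grad f x) v + eta / 2 * dot v v.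
Proof.
move=> eta0 df sf.
pose p t := f (x + t *: v) -
  (dot (grad f x) v * t + eta / 2 * dot v v * (t * t)).
pose dp t := dot (grad f (x + t *: v)) v -
  (dot (grad f x) v + eta * t * dot v v).
have dpE (t : R) : is_derive t 1 p (dp t).
  apply: is_deriveB; first exact: is_derive_line.
  (* The quadratic is spelled with pointwise operations on functions so that the differentiation
     rules match it. *)
  have dq : is_derive t 1
      (dot (grad f x) v \*: (id : R -> R) +
       (eta / 2 * dot v v) \*: ((id : R -> R) * id))
      (dot (grad f x) v *: (1 : R) +
       (eta / 2 * dot v v) *: (t *: (1 : R) + t *: (1 : R))).
    by do !apply: is_deriveD.
  apply: (is_derive_eq dq); rewrite /GRing.scale /=; lra.
have [t t01 pE] : exists2 t, t \in `]0, 1[%R & p 1 - p 0 = dp t * (1 - 0).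
  apply: MVT => //.
  apply: continuous_subspaceT => t; apply: differentiable_continuous.
  by apply/derivable1_diffP.
have t0 : 0 < t by move: t01; rewrite in_itv => /andP[].
suff : dp t <= 0.
  move: pE; rewrite /p scale1r scale0r addr0; lra.
have := dot_le_sqr _ _ (sf (x + t *: v) x).
have -> : x + t *: v - x = t *: v by rewrite addrC addKr.
rewrite exprMn sqr_enorm dotZl dotZr => gg.
rewrite /dp.
have -> : dot (grad f (x + t *: v)) v =
    dot (grad f (x + t *: v) - grad f x) v + dot (grad f x) v.
  by rewrite -dotDl subrK.
set g := _ - _ in gg *.
(* Weighted AM-GM with weight [eta * t] plays the role of Cauchy-Schwarz. *)
have := dot_le_mean g ((eta * t) *: v); rewrite !(dotZl, dotZr) => gm.
have et0 : 0 < eta * t by rewrite mulr_gt0.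
suff : (eta * t) * (dot g v - eta * t * dot v v) <= 0.
  by rewrite pmulr_rle0 //; lra.
nra.
Qed.

(** * Consensus error of a single cluster *)

Lemma frob2_exp_mulmx (R : realType) (m n : nat) (A : 'M[R]_m)
    (X : 'M[R]_(m, n)) (l : R) (k : nat) :
  A^T = A -> spectral_radius A <= l ->
  frob2 (A ^+ k *m X) <= l ^+ (2 * k) * frob2 X.
Proof.
move=> Asym Al; elim: k => [|k IH]; first by rewrite mul1mx mul1r.
rewrite exprS -[A * _]/(A *m _) -mulmxA mulnS exprD -mulrA.
apply: le_trans (frob2_mulmx _ _ _ _ _ _ Asym Al) _.
by rewrite ler_wpM2l // sqr_ge0.
Qed.

Lemma frob2_rowE (R : realType) (m n : nat) (X : 'M[R]_(m, n)) :
  frob2 X = \sum_i dot (row i X) (row i X).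
Proof.
apply: eq_bigr => i _; apply: eq_bigr => j _.
by rewrite mxE expr2.
Qed.

Lemma row_mean_mulmx (R : realType) (n m : nat) (W : 'M[R]_(n, m)) (i : 'I_n) :
  row i ((const_mx n%:R^-1 : 'M[R]_n) *m W) = n%:R^-1 *: \sum_j row j W.
Proof.
apply/rowP => j; rewrite !mxE summxE mulr_sumr.
by apply: eq_bigr => k _; rewrite !mxE.
Qed.

(* [V^theta - 11^T/n] equals [(V - 11^T/n)^theta (1 - 11^T/n)] even for
   [theta = 0], where the factor [1 - 11^T/n] is what survives. *)
Lemma consensus_exp (R : realType) (n : nat) (V : 'M[R]_n) (k : nat) :
  (0 < n)%N -> V^T = V -> V *m const_mx 1 = const_mx 1 :> 'cV[R]_n ->
  let L := const_mx n%:R^-1 in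
  (V - L) ^+ k *m (1%:M - L) = V ^+ k - L.
Proof.
move=> n0 Vsym V1 L.
have VL : V *m L = L.
  apply/matrixP => i j; have /matrixP/(_ i 0) := V1.
  rewrite !mxE => Vi; rewrite -[RHS]mul1r -[X in _ = X * _]Vi mulr_suml.
  by apply: eq_bigr => a _; rewrite !mxE mulr1.
have LL : L *m L = L.
  apply/matrixP => i j; rewrite !mxE (eq_bigr (fun=> n%:R^-1 * n%:R^-1)).
    rewrite sumr_const card_ord -mulrnAl -mulr_natl divff ?mul1r //.
    by rewrite pnatr_eq0 -lt0n.
  by move=> a _; rewrite !mxE.
have LT : L^T = L by apply/matrixP => i j; rewrite !mxE.
have LV : L *m V = L by rewrite -[LHS]trmxK trmx_mul LT Vsym VL.
have LVk a : L *m V ^+ a = L.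
  elim: a => [|a IH]; first by rewrite mulmx1.
  by rewrite exprS -[V * _]/(V *m _) mulmxA LV.
elim: k => [|k IH]; first by rewrite mul1mx.
rewrite exprS -[(V - L) * _]/((V - L) *m _) -mulmxA IH.
rewrite mulmxBl !mulmxBr LVk LL VL subrr subr0.
by rewrite exprS.
Qed.

(** Every row of [L W] is the mean row, so [e] is [n] times row [c] of [(V - L)^k (1 - L) W]. The
    scaling contributes [n^2] and the [n] centred rows contribute [n U^2], whence the cube. *)
Lemma consensus_error (R : realType) (n m : nat) (V : 'M[R]_n)
    (W : 'M[R]_(n, m)) (c : 'I_n) (k : nat) (l U : R) (e : 'rV[R]_m) :
  V^T = V -> V *m const_mx 1 = const_mx 1 :> 'cV[R]_n ->
  spectral_radius (V - const_mx n%:R^-1) <= l ->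
  (forall i j, enorm (row i W - row j W) <= U) ->
  e = n%:R *: row c (V ^+ k *m W) - \sum_j row j W ->
  dot e e <= n%:R ^+ 3 * l ^+ (2 * k) * U ^+ 2.
Proof.
move=> Vsym V1 Vl WU e_def; set L := const_mx _ in Vl.
have n0 : (0 < n)%N by case: n c {V W Vsym V1 L Vl WU e_def} => [[]|].
have nR0 : n%:R != 0 :> R by rewrite pnatr_eq0 -lt0n.
have eE : e = n%:R *: row c ((V - L) ^+ k *m ((1%:M - L) *m W)).
  rewrite e_def mulmxA consensus_exp // mulmxBl linearB /=.
  rewrite row_mean_mulmx scalerBr.
  by rewrite scalerA mulfV // scale1r.
have VLsym : (V - L)^T = V - L.
  by rewrite linearB /= Vsym; congr (_ - _); apply/matrixP => i j; rewrite !mxE.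
have spread : frob2 ((1%:M - L) *m W) <= n%:R * U ^+ 2.
  rewrite frob2_rowE mulr_natl -[X in _ *+ X](card_ord n) -sumr_const.
  apply: ler_sum => i _; rewrite mulmxBl mul1mx linearB /= row_mean_mulmx.
  (* A deviation from the mean is the mean of pairwise differences, each of norm at most [U]. *)
  have -> : row i W - n%:R^-1 *: \sum_j row j W =
      n%:R^-1 *: \sum_j (row i W - row j W).
    rewrite sumrB sumr_const card_ord scalerBr -(scaler_nat n (row i W)).
    by rewrite scalerA mulVf // scale1r.
  rewrite dotZl dotZr mulrA.
  apply: (@le_trans _ _ (n%:R^-1 * n%:R^-1 * (n%:R * \sum_(j < n) U ^+ 2))).
    rewrite ler_wpM2l ?mulr_ge0 ?invr_ge0 ?ler0n //.
    apply: le_trans (dot_sum_le _ _) _; rewrite card_ord ler_wpM2l ?ler0n //.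
    by apply: ler_sum => j _; apply: dot_le_sqr.
  rewrite sumr_const card_ord -(mulr_natl (U ^+ 2)).
  have -> // : n%:R^-1 / n%:R * (n%:R * (n%:R * U ^+ 2)) = U ^+ 2 by field.
rewrite eE dotZl dotZr mulrA.
set Y := _ *m _.
(* The sampled index [c] is arbitrary, so its row is bounded by all rows together. *)
have rowY : dot (row c Y) (row c Y) <= frob2 Y.
  by rewrite frob2_rowE (bigD1 c) //= lerDl sumr_ge0 // => i _; apply: dot_ge0.
have Yl : frob2 Y <= l ^+ (2 * k) * (n%:R * U ^+ 2).
  apply: le_trans (frob2_exp_mulmx _ _ _ _ _ _ _ VLsym Vl) _.
  by rewrite ler_wpM2l // mulnC exprM sqr_ge0.
have -> : n%:R ^+ 3 * l ^+ (2 * k) * U ^+ 2 =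
    n%:R * n%:R * (l ^+ (2 * k) * (n%:R * U ^+ 2)) by ring.
by rewrite ler_wpM2l ?mulr_ge0 ?ler0n // (le_trans rowY).
Qed.

(** * Aggregation errors across the layers *)

Lemma sum_children (J : nat) (H : network J) (V : nmodType) (k j : nat)
    (F : node H j.+1 -> V) :
  (0 < k)%N -> (j < J)%N ->
  \sum_(n : node H j) \sum_(i in children H k n) F i = \sum_q F q.
Proof.
move=> k0 jJ; rewrite (exchange_big_dep predT) //=; apply: eq_bigr => q _.
(* Each [q] has exactly one parent: covering gives existence, disjointness gives uniqueness. *)
have [n qn] := @children_cover J H k j q k0 jJ.
rewrite (big_pred1 n) // => n'; apply/idP/eqP => [qn'|-> //].
apply/eqP; apply: contraT => nn'.
have /disjointFl /(_ qn) := @children_disjoint J H k j n' n k0 jJ nn'.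
by rewrite qn'.
Qed.

(** Deviation from exact summation; in a run of MH-FL it vanishes for EUT clusters and is the
    sampling error for LUT clusters. *)
Definition aggregation_error {R : realType} {J : nat} {H : network J} {M : nat}
    (wt : nat -> forall j, node H j -> 'rV[R]_M) (k j : nat)
    (n : node H j) :=
  wt k j n - \sum_(i in children H k n) wt k j.+1 i.

(** Induction on the depth [m]: each node of layer [m] is replaced by the sum of its children plus
    its error, and the clusters partition layer [m + 1]. *)
Lemma sum_aggregation_error (R : realType) (J : nat) (H : network J) (M : nat)
    (wt : nat -> forall j, node H j -> 'rV[R]_M) (k m : nat) :
  (0 < k)%N -> (m <= J)%N ->
  wt k 0%N (server H) = \sum_(n : node H m) wt k m n +
    \sum_(j < m) \sum_(n : node H j) aggregation_error wt k j n.
Proof.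
move=> k0; elim: m => [|m IH] mJ.
  rewrite big_ord0 addr0 (big_pred1 (server H)) // => n.
  by rewrite (serverP n); apply/esym/eqP.
rewrite (IH (ltnW mJ)) big_ord_recr /= sumrB (sum_children _ _ _ k) //.
by rewrite [RHS]addrC -addrA subrK addrC.
Qed.

(** The double sum is flattened to a single one over pairs of a layer and a node. The number of such
    pairs is the source of the factor [Phi]. *)
Lemma dot_sum2_le (R : realType) (M J : nat) (T : nat -> finType)
    (F : forall j, T j -> 'rV[R]_M) :
  let e := \sum_(j < J) \sum_(n : T j) F j n in
  dot e e <= (\sum_(j < J) #|T j|)%:R *
    \sum_(j < J) \sum_(n : T j) dot (F j n) (F j n).
Proof.
have flat (V : nmodType) (G : forall j, T j -> V) : \sum_(j < J) \sum_n G j n =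
    \sum_(p : {j : 'I_J & T j}) G (tag p) (tagged p) by rewrite sig_big_dep.
rewrite /= (flat _ F) (flat _ (fun j n => dot (F j n) (F j n))).
apply: le_trans (dot_sum_le _ _) _.
by rewrite card_tagged sumnE big_map big_enum.
Qed.

(** * Differentiability and gradient of the global loss *)

Section GlobalLoss.
Context (R : realType) (J : nat) (H : network J) (M : nat).
Context (data : node H J -> finType) (f : node H J -> 'rV[R]_M -> R).
Hypothesis df : forall n x, differentiable (f n) x.

Lemma global_lossE :
  global_loss data f =
  (data_total data)%:R^-1 \*: \sum_n (#|data n|%:R \*: f n).
Proof.
by apply/funext => x; rewrite /global_loss /= fct_sumE.
Qed.

Lemma differentiable_global_loss x : differentiable (global_loss data f) x.
Proof.
rewrite global_lossE; apply: differentiableZ.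
elim/big_ind: _ => [|g h dg dh|n _].
- exact: differentiable_cst.
- exact: differentiableD.
- exact: differentiableZ.
Qed.

Lemma grad_global_loss x :
  grad (global_loss data f) x =
  (data_total data)%:R^-1 *: \sum_n #|data n|%:R *: grad (f n) x.
Proof.
apply/rowP => i; rewrite !mxE summxE; set v := delta_mx _ _.
have df' n : derivable (f n) x v by apply: diff_derivable.
suff : is_derive x v (global_loss data f)
    ((data_total data)%:R^-1 *: \sum_n #|data n|%:R *: 'D_v (f n) x).
  move=> dF; rewrite derive_val; congr (_ *: _).
  by apply: eq_bigr => n _; rewrite !mxE.
rewrite global_lossE; apply: is_deriveZ.
elim/big_ind2: _ => [|g g' h h' dg dh|n _].
- exact: is_derive_cst.
- exact: is_deriveD.
- by apply: is_deriveZ; apply: derivableP.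
Qed.
End GlobalLoss.

(** * One inexact gradient step *)

(** Nonnegativity of [|mu d + g|^2] with [d = y - x] and [g = grad f x] amounts to minimising the
    strong convexity lower bound over [d]. *)
Lemma polyak_lojasiewicz (R : realType) (M : nat) (mu : R) (f : 'rV[R]_M -> R)
    (x y : 'rV[R]_M) :
  0 < mu -> strongly_convex mu f ->
  2 * mu * (f x - f y) <= dot (grad f x) (grad f x).
Proof.
move=> mu0 cf; have := cf x y; rewrite sqr_enorm.
move: (y - x) (grad f x) => d g; have := dot_ge0 (mu *: d + g).
rewrite !(dotDl, dotDr, dotZl, dotZr) (dotC g d).
nra.
Qed.

Lemma inexact_gradient_step (R : realType) (M : nat) (f : 'rV[R]_M -> R)
    (mu eta : R) (x e y : 'rV[R]_M) :
  0 < mu -> 0 < eta -> (forall z, differentiable f z) ->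
  strongly_convex mu f -> smooth eta f ->
  f (x - (1 / eta) *: grad f x + e) - f y <=
    (1 - mu / eta) * (f x - f y) + eta / 2 * dot e e.
Proof.
move=> mu0 eta0 df cf sf.
have := descent _ _ f eta x (e - (1 / eta) *: grad f x) eta0 df sf.
have pl := polyak_lojasiewicz _ _ mu f x y mu0 cf.
rewrite [x + (_ - _)]addrCA [e + (_ - _)]addrC; set p := f (_ + e).
move: (grad f x) pl => g pl.
rewrite !(dotDl, dotDr, dotNl, dotNr, dotZl, dotZr) (dotC e g) => de.
have : mu / eta * (f x - f y) <= dot g g / (2 * eta).
  rewrite ler_pdivlMr ?mulr_gt0 //.
  have -> // : mu / eta * (f x - f y) * (2 * eta) = 2 * mu * (f x - f y).
  by field; rewrite gt_eqF.
suff : p <= f x - dot g g / (2 * eta) + eta / 2 * dot e e by lra.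
(* The two sides are equal: at step size [1 / eta] the terms in [dot g e] cancel. *)
apply: (le_trans de); rewrite le_eqVlt; apply/orP; left; apply/eqP.
by field; rewrite gt_eqF.
Qed.

(** * MH-FL as perturbed gradient descent, and its convergence *)

Lemma aggregation_error_le (R : realType) (J : nat) (H : network J)
    (P : d2d R H) (M : nat) (data : node H J -> finType)
    (f : node H J -> 'rV[R]_M -> R) (beta : R) (w0 : 'rV[R]_M)
    (w : nat -> 'rV[R]_M) (wt : nat -> forall j, node H j -> 'rV[R]_M)
    (Upsilon : nat -> forall j, node H j -> R) (k j : nat) (n : node H j) :
  mhfl P data f beta w0 w wt -> divergence_bound wt Upsilon ->
  (lut P k n -> consensus_conditions P k n) -> (0 < k)%N -> (j < J)%N ->
  let e := aggregation_error wt k j n in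
  dot e e <= (lut P k n)%:R * #|children H k n|%:R ^+ 3 *
    rate P k n ^+ (2 * rounds P k n) * Upsilon k j n ^+ 2 :> R.
Proof.
move=> run div cons k0 jJ /=.
case: (boolP (lut P k n)) => [lutn|eutn]; last first.
  rewrite /aggregation_error (mhfl_eut run) // subrr dot0l.
  by rewrite !mul0r.
have [_ _ _ V1 Vsym Vrate _] := cons lutn.
have [c wtn] := mhfl_lut run k0 jJ lutn; rewrite mul1r.
apply: (consensus_error _ _ _ _ (cluster_mx wt k n) c _ _ _ _ Vsym V1 Vrate).
  by move=> a b; rewrite !rowK; apply: div => //; apply: enum_valP.
rewrite /aggregation_error wtn [in LHS]big_enum_val; congr (_ - _).
by apply: eq_bigr => i _; rewrite rowK.
Qed.

(** The weights [#|data n|] sum to [data_total], so the weighted mean of the device updates is an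
    exact gradient step on the global loss; telescoping down to layer [J] adds the errors. *)
Lemma mhfl_step (R : realType) (J : nat) (H : network J)
    (P : d2d R H) (M : nat) (data : node H J -> finType)
    (f : node H J -> 'rV[R]_M -> R) (beta : R) (w0 : 'rV[R]_M)
    (w : nat -> 'rV[R]_M) (wt : nat -> forall j, node H j -> 'rV[R]_M)
    (k : nat) :
  (forall n x, differentiable (f n) x) -> (0 < data_total data)%N ->
  mhfl P data f beta w0 w wt -> (0 < k)%N ->
  w k = w k.-1 - beta *: grad (global_loss data f) (w k.-1) +
    (data_total data)%:R^-1 *:
      \sum_(j < J) \sum_(n : node H j) aggregation_error wt k j n.
Proof.
move=> df D0 run k0; rewrite (mhfl_server run) //.
rewrite (sum_aggregation_error _ _ _ _ _ _ J) // scalerDr; congr (_ + _).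
under eq_bigr do rewrite (mhfl_device run) // scalerBr scalerA mulrC -scalerA.
rewrite sumrB -scaler_suml -natr_sum -/(data_total data) scalerBr scalerA.
rewrite mulVf ?pnatr_eq0 -?lt0n // scale1r -scaler_sumr.
by rewrite scalerA mulrC -scalerA -grad_global_loss.
Qed.

Theorem theorem1 (R : realType) (J : nat) (H : network J) (P : d2d R H)
    (M : nat) (data : node H J -> finType) (f : node H J -> 'rV[R]_M -> R)
    (mu eta : R) (w0 wstar : 'rV[R]_M) (w : nat -> 'rV[R]_M)
    (wt : nat -> forall j, node H j -> 'rV[R]_M)
    (Upsilon : nat -> forall j, node H j -> R)
    (hJ : (1 <= J)%N)
    (hdata : forall n, (0 < #|data n|)%N)
    (hf : forall n x, differentiable (f n) x)
    (hmu : 0 < mu) (hmueta : mu < eta)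
    (hconvex : strongly_convex mu (global_loss data f))
    (hsmooth : smooth eta (global_loss data f))
    (hstar : forall x, global_loss data f wstar <= global_loss data f x)
    (hcons : forall k j (n : node H j), (0 < k)%N -> (j < J)%N ->
       lut P k n -> consensus_conditions P k n)
    (hrun : mhfl P data f (1 / eta) w0 w wt)
    (hUpsilon : divergence_bound wt Upsilon)
    (k : nat) (hk : (1 <= k)%N) :
  global_loss data f (w k) - global_loss data f wstar <=
    (1 - mu / eta) ^+ k * (global_loss data f w0 - global_loss data f wstar)
    + eta * (Phi H)%:R / (2 * (data_total data)%:R ^+ 2) *
      \sum_(0 <= t < k) (1 - mu / eta) ^+ t * Xi P Upsilon (k - t)%N.
Proof.
have eta0 : 0 < eta by apply: lt_trans hmueta.
have D0 : (0 < data_total data)%N.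
  have /card_gt0P [n _] := @node_gt0 J H J (leqnn J).
  by rewrite /data_total (bigD1 n) //= addn_gt0 hdata.
set F := global_loss data f in hconvex hsmooth hstar *.
set c := eta * (Phi H)%:R / (2 * (data_total data)%:R ^+ 2).
(* Here [mu < eta] enters: the induction multiplies an inequality by this factor. *)
have q0 : 0 <= 1 - mu / eta by rewrite subr_ge0 ler_pdivrMr // mul1r ltW.
have step s : (0 < s)%N -> F (w s) - F wstar <=
    (1 - mu / eta) * (F (w s.-1) - F wstar) + c * Xi P Upsilon s.
  move=> s0; rewrite (mhfl_step _ _ _ _ _ _ _ _ _ _ _ _ hf D0 hrun s0).
  set E := \sum_(j < J) _.
  have Ele : dot E E <= (Phi H)%:R * Xi P Upsilon s.
    apply: le_trans (dot_sum2_le _ _ _ _ _) _; rewrite ler_wpM2l ?ler0n //.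
    apply: ler_sum => j _; apply: ler_sum => n _.
    by apply: aggregation_error_le hrun hUpsilon _ _ _ => //; apply: hcons.
  apply: le_trans (inexact_gradient_step _ _ _ mu eta _ _ _ _ _ _ _ _) _ => //.
    by move=> z; apply: differentiable_global_loss.
  rewrite lerD2l dotZl dotZr.
  (* The constant splits into [eta / 2] from smoothness, two factors [1 / D] from the averaging at
     the server, and [Phi] from the number of errors. *)
  have -> : c * Xi P Upsilon s = eta / 2 * ((data_total data)%:R^-1 *
      ((data_total data)%:R^-1 * ((Phi H)%:R * Xi P Upsilon s))).
    by rewrite /c; field; rewrite pnatr_eq0 -lt0n.
  by rewrite !ler_wpM2l ?invr_ge0 ?ler0n ?divr_ge0 ?(ltW eta0).
elim: k hk => // s IH _.
(* Splitting off [t = 0] isolates [Xi] at iteration [s + 1], the newest error; the shifted remainder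
   is [1 - mu / eta] times the previous sum. *)
apply: le_trans (step s.+1 isT) _; rewrite /= big_nat_recl // subn0 expr0 mul1r.
rewrite (eq_bigr (fun t => (1 - mu / eta) *
    ((1 - mu / eta) ^+ t * Xi P Upsilon (s - t)))); last first.
  by move=> t _; rewrite exprS mulrA subSS.
rewrite -mulr_sumr exprS.
set S := \sum_(0 <= t < s) _ in IH *.
(* The induction hypothesis requires [s >= 1]; at [s = 0] the sum is empty and [w 0 = w0]. *)
have {}IH : F (w s) - F wstar <=
    (1 - mu / eta) ^+ s * (F w0 - F wstar) + c * S.
  case: s @S IH => [|s] S IH; last exact: IH.
  by rewrite /S big_geq // mulr0 addr0 mul1r (mhfl_init hrun).
have := ler_wpM2l q0 IH; lra.
Qed.
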